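(* For every integer $n\ge0$, $$\overline{pp}(3n+2)\equiv0\pmod3.$$
   Context: An overpartition is an integer partition in which the first occurrence of each part size may be overlined (the empty overpartition is allowed). An overpartition pair of $n$ is an ordered pair of overpartitions $(\mu,\lambda)$ such that the sum of all parts of $\mu$ and $\lambda$ together is $n$. $\overline{pp}(n)$ is the number of overpartition pairs of $n$; for example, $\overline{pp}(2)=12$. *)

(* Defs.v *)
From mathcomp Require Import all_boot.

Set Implicit Arguments.
Unset Strict Implicit.
Unset Printing Implicit Defensive.

(* An overpartition is the list of its parts in weakly decreasing order; a part
   is a pair (size, overlined?).  In the second clause, q occurs after p, so it
   may not be overlined if it has the same size. *)
Definition is_overpartition (s : seq (nat * bool)) : bool :=
  all (fun p => 0 < p.1) s &&
  pairwise (fun p q => (q.1 <= p.1) && ((q.1 == p.1) ==> ~~ q.2)) s.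

Definition weight (s : seq (nat * bool)) : nat := \sum_(p <- s) p.1.

Definition is_overpartition_pair (n : nat)
    (ml : seq (nat * bool) * seq (nat * bool)) : bool :=
  [&& is_overpartition ml.1, is_overpartition ml.2
    & weight ml.1 + weight ml.2 == n].

(* The lists of length at most n with part sizes at most n form a finite type,
   which is used only to count; [bounded_pair_inj] and [bounded_pair_surj] show
   that it contains each overpartition pair of n exactly once. *)
Definition bounded_list (n : nat) : finType := n.-bseq ('I_n.+1 * bool).

Definition list_of (n : nat) (u : bounded_list n) : seq (nat * bool) :=
  [seq (val p.1, p.2) | p <- bseqval u].

Definition pair_of (n : nat) (u : bounded_list n * bounded_list n) :
    seq (nat * bool) * seq (nat * bool) :=
  (list_of u.1, list_of u.2).

Definition overpartition_pairs (n : nat) :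
    {set bounded_list n * bounded_list n} :=
  [set u | is_overpartition_pair n (pair_of u)].

Definition pp (n : nat) : nat := #|overpartition_pairs n|.

Lemma list_of_inj (n : nat) : injective (@list_of n).
Proof.
move=> u v; rewrite /list_of => eq_uv; apply: val_inj.
apply: (inj_map _ eq_uv) => -[i b] [j c] /= [] /val_inj -> -> //.
Qed.

Lemma bounded_pair_inj (n : nat) : injective (@pair_of n).
Proof. by case=> u1 u2 [v1 v2] [] /list_of_inj -> /list_of_inj ->. Qed.

Lemma list_of_surj (n : nat) (s : seq (nat * bool)) :
  is_overpartition s -> weight s <= n -> exists u : bounded_list n, list_of u = s.
Proof.
move=> /andP[pos_s _] le_sn.
have size_le : size s <= n.
  apply: leq_trans le_sn; rewrite -sum1_size /weight big_seq [leqRHS]big_seq.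
  by apply: leq_sum => p p_s; apply: (allP pos_s).
have part_le p : p \in s -> p.1 <= n.
  by move=> p_s; apply: leq_trans le_sn; rewrite /weight (big_rem p) //= leq_addr.
have size_map_le : size [seq (inord p.1 : 'I_n.+1, p.2) | p <- s] <= n.
  by rewrite size_map.
exists (Bseq size_map_le); rewrite /list_of /= -map_comp -[RHS]map_id.
by apply/eq_in_map => -[k b] /part_le /= le_kn; rewrite inordK.
Qed.

Lemma bounded_pair_surj (n : nat) (ml : seq (nat * bool) * seq (nat * bool)) :
  is_overpartition_pair n ml ->
  exists2 u, u \in overpartition_pairs n & pair_of u = ml.
Proof.
case: ml => m l ml_n; have /and3P[/= m_op l_op /eqP w_n] := ml_n.
have [|u um] := @list_of_surj n m m_op; first by rewrite -w_n leq_addr.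
have [|v vl] := @list_of_surj n l l_op; first by rewrite -w_n leq_addl.
by exists (u, v); rewrite ?inE /pair_of /= um vl.
Qed.

(* Main.v *)
(** With [A] the generating series of overpartitions, that of overpartition
    pairs is [A ^ 2].  Gauss's identity [A * S = 1], where [S] is the sum of
    [(-1) ^ j * q ^ (j ^ 2)] over all integers [j], gives [A ^ 2 = A ^ 3 * S].
    Modulo 3 the series [A ^ 3] only involves powers of [q ^ 3], and the exponents
    in [S] are squares, hence never 2 modulo 3.  Gauss's identity is proved modulo
    [q ^ (n + 1)] by a finite version in the style of Shanks, in which the error
    terms are visibly divisible by [q ^ (n + 1)]. *)
Require Import Defs.
From mathcomp Require Import all_boot.
From mathcomp Require Import all_algebra ring.

Set Implicit Arguments.
Unset Strict Implicit.
Unset Printing Implicit Defensive.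

Import GRing.Theory.

(** * A finite form of Gauss's identity *)

Section FiniteGauss.
Local Open Scope ring_scope.
Variables (R : comNzRingType) (q : R).

Definition prod1B (m n : nat) : R := \prod_(m <= k < n) (1 - q ^+ k.+1).
Definition prod1D (n : nat) : R := \prod_(0 <= k < n) (1 + q ^+ k.+1).
(** Partial sum of [S] over |j| <= n: the equal terms for j and -j are merged, whence the factor
    2. *)
Definition theta (n : nat) : R :=
  1 + \sum_(0 <= s < n) (-1) ^+ s.+1 * q ^+ (s.+1 ^ 2) *+ 2.
(** The error in the finite identity is the case [k = n]; a separate bound [k] allows induction on
    [k] at fixed [n]. *)
Definition theta_tail (n k : nat) : R :=
  \sum_(0 <= s < k)
    (-1) ^+ s.+1 * q ^+ (s.+1 * n.+1) * prod1D s * prod1B s.+1 n *+ 2.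

Lemma prod1B_recl m n : (m < n)%N ->
  prod1B m n = (1 - q ^+ m.+1) * prod1B m.+1 n.
Proof. by move=> lt_mn; rewrite /prod1B big_ltn. Qed.

Lemma prod1B_recr m n : (m <= n)%N ->
  prod1B m n.+1 = prod1B m n * (1 - q ^+ n.+1).
Proof. by move=> le_mn; rewrite /prod1B big_nat_recr. Qed.

Lemma prod1D_recr n : prod1D n.+1 = prod1D n * (1 + q ^+ n.+1).
Proof. by rewrite /prod1D big_nat_recr. Qed.

(* At [k = n] this is the recurrence in [n] behind [theta_mul_prod1D]; for fixed
   [n] the sums on the left telescope in [k]. *)
Lemma theta_tail_telescope n k : (k <= n)%N ->
  prod1B 0 n.+1 + theta_tail n.+1 k
    - (1 + q ^+ n.+1) * (prod1B 0 n + theta_tail n k)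
  = - ((-1) ^+ k * q ^+ (k.+1 * n.+1) * prod1D k * prod1B k n *+ 2).
Proof.
elim: k => [_|k IHk lt_kn].
  rewrite /theta_tail !big_geq // prod1B_recr // /prod1D big_geq // mul1n; ring.
have {IHk} := IHk (ltnW lt_kn).
rewrite /theta_tail !big_nat_recr //= => IHk.
rewrite [prod1B k.+1 n.+1]prod1B_recr // (prod1B_recl lt_kn) in IHk *.
rewrite prod1D_recr.
rewrite (_ : k.+1 * n.+2 = k.+1 * n.+1 + k.+1)%N; last by rewrite mulnS addnC.
rewrite (_ : k.+2 * n.+1 = k.+1 * n.+1 + n.+1)%N; last by rewrite mulSn addnC.
set u := \sum_(0 <= i < k) _ in IHk *; set v := \sum_(0 <= i < k) _ in IHk *.
move: IHk; rewrite !exprD ![(-1) ^+ k.+1]exprS.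
move: (prod1B 0 n.+1) (prod1B 0 n) (q ^+ (k.+1 * n.+1)) (q ^+ n.+1) (q ^+ k.+1).
move=> a b x y z IHk.
(* Regrouping makes the left side of the induction hypothesis occur literally. *)
rewrite (_ : forall d e, a + (u + d) - (1 + y) * (b + (v + e)) =
  a + u - (1 + y) * (b + v) + d - (1 + y) * e); last by move=> *; ring.
rewrite IHk; ring.
Qed.

Lemma theta_mul_prod1D n :
  theta n * prod1D n = prod1B 0 n + theta_tail n n.
Proof.
elim: n => [|n IHn].
  by rewrite /theta /prod1D /theta_tail /prod1B !big_geq // !addr0 mulr1.
have /eqP := theta_tail_telescope (leqnn n); rewrite subr_eq -IHn => /eqP E.
(* The last summand of the tail, with exponent (n+1)(n+2), and the telescoping remainder, with
   exponent (n+1)^2, add up to the new term of [theta] times [prod1D n.+1]. *)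
rewrite {1}/theta_tail big_nat_recr //= -/(theta_tail n.+1 n) addrA E.
rewrite prod1D_recr {1}/theta big_nat_recr //= addrA -/(theta n).
rewrite /prod1B !big_geq // (_ : n.+1 ^ 2 = n.+1 * n.+1)%N; last by rewrite expnS expn1.
rewrite (_ : n.+1 * n.+2 = n.+1 * n.+1 + n.+1)%N; last by rewrite mulnS addnC.
rewrite exprD exprS; ring.
Qed.

End FiniteGauss.

(** * Recursive enumeration of overpartitions by largest part *)

Section Enumeration.

Implicit Types (s : seq (nat * bool)) (k m f : nat).

(* [f] is fuel, sufficient for [0 < k] as soon as [m <= f]. *)
Fixpoint not_over (prev : nat -> seq (seq (nat * bool))) k f m :=
  prev m ++ if f is f'.+1 then
    if k <= m then map (cons (k, false)) (not_over prev k f' (m - k)) else [::]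
  else [::].

(** Only the first occurrence of [k] may be overlined, so an overlined [k] can only be the head, and
    the rest is then a [not_over] list. *)
Fixpoint overpartitions k m : seq (seq (nat * bool)) :=
  if k is k'.+1 then
    not_over (overpartitions k') k m m ++
    if k <= m then
      map (cons (k, true)) (not_over (overpartitions k') k (m - k) (m - k))
    else [::]
  else if m == 0 then [:: [::]] else [::].

Definition parts_le k s := all (fun p => p.1 <= k) s.
Definition op_of k m s := [&& is_overpartition s, parts_le k s & weight s == m].
Definition not_over_of k m s := op_of k m s && ((k, true) \notin s).

Lemma weight_cons p s : weight (p :: s) = p.1 + weight s.
Proof. by rewrite /weight big_cons. Qed.

Lemma is_overpartition_cons k b s : is_overpartition ((k, b) :: s) =
  [&& 0 < k, is_overpartition s, parts_le k s & (k, true) \notin s].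
Proof.
rewrite /is_overpartition /= -!andbA; congr (_ && _); congr (_ && _).
rewrite andbC; congr (_ && _).
rewrite /parts_le all_predI; congr (_ && _).
apply/allP/idP => [H|ks]; first by apply/negP => /H; rewrite /= eqxx.
by move=> [j c] js /=; apply/implyP => /eqP jk; apply: contraNN ks => /= <-; rewrite -jk.
Qed.

Lemma parts_leW k s : parts_le k s -> parts_le k.+1 s.
Proof. by apply: sub_all => p /leqW. Qed.

Lemma parts_le_notin k b s : parts_le k s -> (k.+1, b) \notin s.
Proof. by move=> /allP sk; apply/negP => /sk; rewrite /= ltnn. Qed.

(** The three cases mirror the branches of the enumeration. In the last two, an overlined [k.+1] in
    the tail would be a second occurrence of that size. *)
Lemma parts_leS k s : is_overpartition s -> parts_le k.+1 s ->
  [\/ parts_le k s, exists2 t, s = (k.+1, true) :: t & not_over_of k.+1 (weight t) t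
    | exists2 t, s = (k.+1, false) :: t & not_over_of k.+1 (weight t) t].
Proof.
case: s => [|[j b] s]; first by move=> *; constructor 1.
rewrite is_overpartition_cons => /and4P[j0 s_op sj js] /=.
rewrite /parts_le /= leq_eqVlt => /andP[/orP[/eqP jk | lt_jk] _]; last first.
  constructor 1; rewrite -ltnS lt_jk /=.
  by apply: sub_all sj => p /leq_trans; apply.
rewrite jk in sj js *.
have st : not_over_of k.+1 (weight s) s.
  by rewrite /not_over_of /op_of s_op sj eqxx.
by case: b; [constructor 2|constructor 3]; exists s.
Qed.

Lemma not_over_of_cons k b m t : k.+1 <= m -> not_over_of k.+1 (m - k.+1) t ->
  op_of k.+1 m ((k.+1, b) :: t).
Proof.
move=> le_km /andP[/and3P[t_op tk /eqP wt] tNk].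
rewrite /op_of is_overpartition_cons t_op tk tNk weight_cons wt subnKC //= eqxx.
by rewrite ltnS leqnn -/(parts_le _ _) tk.
Qed.

Lemma op_of_not_over k m s : op_of k m s -> not_over_of k.+1 m s.
Proof.
move=> /and3P[s_op sk ws].
by rewrite /not_over_of /op_of s_op ws parts_leW // parts_le_notin.
Qed.

Lemma mem_not_over prev k f m s :
    (forall m' s', (s' \in prev m') = op_of k m' s') -> m <= f ->
  (s \in not_over prev k.+1 f m) = not_over_of k.+1 m s.
Proof.
move=> prevP; elim: f m s => [|f IHf] m s le_mf /=; rewrite mem_cat prevP.
  apply/idP/idP => [/orP[/op_of_not_over|] // |].
  case/andP => /and3P[s_op sk /eqP ws] sNk; rewrite orbF.
  have [sk'|[t st _]|[t st _]] := parts_leS s_op sk.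
  - by rewrite /op_of s_op sk' ws /=.
  - by rewrite st mem_head in sNk.
  (* Without fuel [m = 0], which excludes a part [k.+1]. *)
  - by move: le_mf; rewrite -ws st weight_cons.
have le_sub : m - k.+1 <= f.
  by rewrite leq_subLR (leq_trans le_mf) // addSn ltnS leq_addl.
apply/idP/idP => [/orP[/op_of_not_over //|]|].
  case: ifP => // le_km /mapP[t]; rewrite IHf // => tP ->.
  rewrite /not_over_of not_over_of_cons //= inE negb_or xpair_eqE /= andbF /=.
  by case/andP: tP.
case/andP => /and3P[s_op sk /eqP ws] sNk.
have [sk'|[t st _]|[t st tP]] := parts_leS s_op sk.
- by rewrite /op_of s_op sk' ws eqxx.
- by rewrite st mem_head in sNk.
have wm : m = k.+1 + weight t by rewrite -ws st weight_cons.
have le_km : k.+1 <= m by rewrite wm leq_addr.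
rewrite le_km st; apply/orP; right; apply: map_f.
by rewrite IHf // wm addKn.
Qed.

Lemma mem_overpartitions k m s : (s \in overpartitions k m) = op_of k m s.
Proof.
elim: k m s => [|k IHk] m s /=.
  case: s => [|[j b] s]; rewrite /op_of.
    by rewrite /weight big_nil eq_sym; case: ifP.
  rewrite is_overpartition_cons /= leqn0.
  by case: j => [|j]; rewrite ?andbF //=; case: ifP.
rewrite mem_cat mem_not_over //.
apply/idP/idP => [/orP[/andP[] //|]|].
  case: ifP => // le_km /mapP[t]; rewrite mem_not_over // => tP ->.
  exact: not_over_of_cons.
move=> sP; have /and3P[s_op sk /eqP ws] := sP.
have [sk'|[t st tP]|[t st tP]] := parts_leS s_op sk.
- by rewrite op_of_not_over // /op_of s_op sk' ws eqxx.
- have wm : m = k.+1 + weight t by rewrite -ws st weight_cons.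
  have le_km : k.+1 <= m by rewrite wm leq_addr.
  rewrite le_km st; apply/orP; right; apply: map_f.
  by rewrite mem_not_over // wm addKn.
apply/orP; left; rewrite /not_over_of sP st inE negb_or xpair_eqE /= andbF /=.
by case/andP: tP.
Qed.

Lemma not_over_uniq prev k f m :
    (forall m' s', (s' \in prev m') = op_of k m' s') ->
    (forall m', uniq (prev m')) ->
  uniq (not_over prev k.+1 f m).
Proof.
move=> prevP prev_uniq; elim: f m => [|f IHf] m /=; first by rewrite cats0.
rewrite cat_uniq prev_uniq; case: ifP => //= _; apply/andP; split.
  apply/hasPn => _ /mapP[t _ ->]; rewrite prevP /op_of.
  by rewrite /parts_le /= ltnn /= andbF.
by rewrite map_inj_uniq // => s t [].
Qed.

Lemma overpartitions_uniq k m : uniq (overpartitions k m).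
Proof.
elim: k m => [|k IHk] m /=; first by case: ifP.
have no_uniq f m' := not_over_uniq f m' (mem_overpartitions k) IHk.
rewrite cat_uniq no_uniq; case: ifP => //= _; apply/andP; split.
  (* The two branches are disjoint: only the second one produces an overlined [k.+1]. *)
  apply/hasPn => _ /mapP[t _ ->]; rewrite /= mem_not_over; last exact: leqnn.
    by rewrite /not_over_of mem_head andbF.
  exact: mem_overpartitions.
by rewrite map_inj_uniq // => s t [].
Qed.

Lemma parts_le_weight n s : weight s <= n -> parts_le n s.
Proof.
move=> le_sn; apply/allP => p ps; apply: leq_trans le_sn.
by rewrite /weight (big_rem p) //= leq_addr.
Qed.

Lemma pp_overpartitions n :
  pp n = \sum_(i < n.+1)
    size (overpartitions n i) * size (overpartitions n (n - i)).
Proof.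
(* Pairs are sorted by the weight [i] of the first component, which makes the blocks disjoint. Parts
   of size at most [n] suffice, since neither weight exceeds [n]. *)
pose L := [seq p | i <- iota 0 n.+1,
                   p <- [seq (s, t) | s <- overpartitions n i,
                                      t <- overpartitions n (n - i)]].
have mem_pairs i p : (p \in [seq (s, t) | s <- overpartitions n i,
                                          t <- overpartitions n (n - i)])
    = op_of n i p.1 && op_of n (n - i) p.2.
  rewrite -!mem_overpartitions; case: p => s t /=.
  apply/allpairsP/andP => [[[s' t'] [/= s'P t'P [-> ->]]] //|[sP tP]].
  by exists (s, t).
have uniq_L : uniq L.
  apply: allpairs_uniq_dep; first exact: iota_uniq.
    by move=> i _; apply: allpairs_uniq; rewrite ?overpartitions_uniq // => -[? ?] [].
  move=> [i p] [j r] /allpairsPdep[i' [p' [_ p'P [-> ->]]]].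
  move=> /allpairsPdep[j' [r' [_ r'P [-> ->]]]] /= E.
  move: p'P r'P; rewrite E !mem_pairs => /andP[/and3P[_ _ /eqP <-] _].
  by case/andP=> /and3P[_ _ /eqP <-].
have mem_L p : (p \in L) = is_overpartition_pair n p.
  apply/allpairsPdep/and3P => [[i [p' [iP p'P ->]]]|[p1 p2 /eqP wp]].
    move: iP p'P; rewrite mem_iota mem_pairs /= add0n ltnS => le_in.
    case/andP => /and3P[-> _ /eqP ->] /and3P[-> _ /eqP ->].
    by rewrite subnKC ?eqxx.
  exists (weight p.1), p; split=> //.
    by rewrite mem_iota /= add0n ltnS -wp leq_addr.
  have wp2 : n - weight p.1 = weight p.2 by rewrite -wp addKn.
  rewrite mem_pairs /op_of p1 p2 wp2 !eqxx !parts_le_weight //.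
    by rewrite -wp leq_addl.
  by rewrite -wp leq_addr.
have perm_L : perm_eq [seq pair_of u | u <- enum (overpartition_pairs n)] L.
  apply: uniq_perm => [||p] //.
    by rewrite (map_inj_uniq (@bounded_pair_inj n)) enum_uniq.
  rewrite mem_L; apply/mapP/idP => [[u uP ->]|/bounded_pair_surj[u uP <-]].
    by rewrite mem_enum inE in uP.
  by exists u; rewrite ?mem_enum.
rewrite /pp cardE -(size_map (@pair_of n)) (perm_size perm_L) size_allpairs_dep.
rewrite sumnE big_map -[iota 0 n.+1]/(index_iota 0 n.+1) big_mkord.
by apply: eq_bigr => i _; rewrite size_allpairs.
Qed.

Lemma not_over_fuel prev k f f' m : m <= f -> m <= f' ->
  not_over prev k.+1 f m = not_over prev k.+1 f' m.
Proof.
elim: f f' m => [|f IHf] [|f'] m //=.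
- by rewrite leqn0 => /eqP ->.
- by move=> _; rewrite leqn0 => /eqP ->.
move=> le_mf le_mf'; case: ifP => // le_km; congr (_ ++ map _ _).
have le_sub g : m <= g.+1 -> m - k.+1 <= g.
  by move=> le_mg; rewrite leq_subLR (leq_trans le_mg) // addSn ltnS leq_addl.
by rewrite (IHf f') ?le_sub.
Qed.

Definition nb_not_over k m := size (not_over (overpartitions k) k.+1 m m).

(** With A_k and C_k the generating series of [overpartitions k] and [nb_not_over k], this says (1 -
    q^(k+1)) C_k = A_k, and [size_overpartitionsS] says A_(k+1) = (1 + q^(k+1)) C_k. *)
Lemma nb_not_overE k m : nb_not_over k m =
  size (overpartitions k m) + (if k < m then nb_not_over k (m - k.+1) else 0).
Proof.
case: m => [|m]; rewrite /nb_not_over /=; first by rewrite cats0 addn0.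
rewrite size_cat; case: ifP => // lt_km; rewrite size_map.
by congr (_ + size _); apply: not_over_fuel; rewrite // subSS leq_subr.
Qed.

Lemma size_overpartitionsS k m : size (overpartitions k.+1 m) =
  nb_not_over k m + (if k < m then nb_not_over k (m - k.+1) else 0).
Proof. by rewrite /= size_cat; case: ifP => //; rewrite size_map. Qed.

End Enumeration.

(** * Truncated generating series and reduction modulo 3 *)

Section GeneratingFunctions.
Local Open Scope ring_scope.

(** Congruence of power series modulo q^N is expressed throughout as divisibility of polynomials by
    ['X^N]. *)
Lemma dvdXnP (F : fieldType) N (p : {poly F}) :
  reflect (forall i, (i < N)%N -> p`_i = 0) ('X^N %| p).
Proof.
apply: (iffP idP) => [/dvdpP[r ->] i lt_iN|p0]; first by rewrite coefMXn lt_iN.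
rewrite -(poly_take_drop N p) dvdp_addl ?dvdp_mull // (_ : take_poly N p = 0) ?dvdp0 //.
by apply/polyP => i; rewrite coef_take_poly coef0; case: ifP => // /p0.
Qed.

Definition op_poly (R : nzRingType) N k : {poly R} :=
  \poly_(m < N) (size (overpartitions k m))%:R.

(** Obtained by eliminating the series [C] of [nb_not_over k] from the two recurrences, each valid
    below degree [N]. *)
Lemma op_polyS (F : fieldType) N k :
  'X^N %| (1 - 'X^(k.+1)) * op_poly F N k.+1 - (1 + 'X^(k.+1)) * op_poly F N k.
Proof.
pose C : {poly F} := \poly_(m < N) (nb_not_over k m)%:R.
have dvdC : 'X^N %| (1 - 'X^(k.+1)) * C - op_poly F N k.
  apply/dvdXnP => i lt_iN.
  rewrite mulrBl mul1r mulrC !coefB coefMXn !coef_poly lt_iN nb_not_overE ltnS.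
  rewrite (leq_ltn_trans (leq_subr _ _) lt_iN) ltnNge.
  by case: (i <= k)%N; rewrite /= natrD; ring.
have dvdA : 'X^N %| op_poly F N k.+1 - (1 + 'X^(k.+1)) * C.
  apply/dvdXnP => i lt_iN.
  rewrite mulrDl mul1r [X in _ - (_ + X)]mulrC coefB coefD coefMXn !coef_poly lt_iN.
  rewrite size_overpartitionsS ltnS (leq_ltn_trans (leq_subr _ _) lt_iN) ltnNge.
  by case: (i <= k)%N; rewrite /= natrD; ring.
rewrite (_ : _ - _ = (1 - 'X^(k.+1)) * (op_poly F N k.+1 - (1 + 'X^(k.+1)) * C) +
  (1 + 'X^(k.+1)) * ((1 - 'X^(k.+1)) * C - op_poly F N k)); last by ring.
by rewrite dvdp_add ?dvdp_mull.
Qed.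

Lemma op_poly_prod (F : fieldType) N k :
  'X^(N.+1) %| op_poly F N.+1 k * prod1B 'X 0 k - prod1D 'X k.
Proof.
elim: k => [|k IHk].
  rewrite /prod1B /prod1D !big_geq // mulr1; apply/dvdXnP => i lt_iN.
  by rewrite coefB coef_poly coef1 lt_iN /=; case: i lt_iN => [|i] _ /=; rewrite subrr.
rewrite prod1B_recr // prod1D_recr.
set B := prod1B _ _ _ in IHk *; set D := prod1D _ _ in IHk *.
rewrite (_ : _ - _ = ((1 - 'X^(k.+1)) * op_poly F N.+1 k.+1
    - (1 + 'X^(k.+1)) * op_poly F N.+1 k) * B
  + (1 + 'X^(k.+1)) * (op_poly F N.+1 k * B - D)); last by ring.
by apply: dvdp_add; [exact/dvdp_mulr/op_polyS | exact: dvdp_mull].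
Qed.

Lemma theta_prod (F : fieldType) n :
  ('X^(n.+1) : {poly F}) %| theta 'X n * prod1D 'X n - prod1B 'X 0 n.
Proof.
rewrite theta_mul_prod1D addrAC subrr add0r /theta_tail.
elim/big_ind: _ => [|p r|s _]; [exact: dvdp0|exact: dvdp_add|].
(* The exponent (s+1)(n+1) splits off a factor q^(n+1). *)
rewrite -mulr_natl mulSn exprD; apply: dvdp_mull; do 2 apply: dvdp_mulr.
by apply: dvdp_mull; apply: dvdp_mulr.
Qed.

Lemma op_poly_theta (F : fieldType) n :
  'X^(n.+1) %| op_poly F n.+1 n * theta 'X n - 1.
Proof.
have dvdA := op_poly_prod F n n; have dvdS := theta_prod F n.
set A := op_poly _ _ _ in dvdA *; set S := theta _ _ in dvdS *.
set B := prod1B _ _ _ in dvdA dvdS; set D := prod1D _ _ in dvdA dvdS.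
(* [B * D] has constant term 1, so it is prime to ['X] and can be cancelled modulo ['X^(n.+1)]. *)
have coBD : coprimep 'X^(n.+1) (B * D).
  apply: coprimep_expl; rewrite coprimep_sym coprimepX /root hornerM.
  rewrite /B /D /prod1B /prod1D !horner_prod mulf_neq0 //;
    rewrite prodf_seq_neq0; apply/allP => i _ /=;
    by rewrite !hornerE expr0n /= ?addr0 ?subr0 oner_eq0.
rewrite -(Gauss_dvdpl _ coBD).
rewrite (_ : (A * S - 1) * (B * D) = (A * B - D) * (S * D) + D * (S * D - B)); last by ring.
by apply: dvdp_add; [exact: dvdp_mulr | exact: dvdp_mull].
Qed.

(** The Frobenius map is additive, so [f ^+ p] is the sum of the f_j^p X^(jp). *)
Lemma coef_exp_pchar (F : fieldType) p (f : {poly F}) i :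
  p \in [pchar F] -> ~~ (p %| i)%N -> (f ^+ p)`_i = 0.
Proof.
move=> pcharF pi; have pcharP : p \in [pchar {poly F}] by exact: (rmorph_pchar polyC).
rewrite -(GRing.pFrobenius_autE pcharP) -[f]coefK poly_def rmorph_sum coef_sum.
apply: big1 => j _; rewrite /= GRing.pFrobenius_autE exprZn -exprM coefZ coefXn.
by case: eqP pi => [->|]; rewrite ?dvdn_mull ?mulr0.
Qed.

Lemma coef_theta (R : comNzRingType) n i :
  (i %% 3 = 2)%N -> (theta ('X : {poly R}) n)`_i = 0.
Proof.
move=> i3; rewrite /theta coefD coef1 coef_sum.
have -> : (i == 0)%N = false by case: i i3.
rewrite add0r big1 // => s _; rewrite coefMn -(rmorph_sign polyC) mul_polyC coefZ coefXn.
have sq3 : ((s.+1 ^ 2) %% 3 != 2)%N.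
  rewrite -modnXm; have := ltn_pmod s.+1 (isT : 0 < 3)%N.
  by case: (s.+1 %% 3)%N => [|[|[|]]].
case: eqP => [i_sq|_]; last by rewrite mulr0 mul0rn.
by rewrite -i_sq i3 in sq3.
Qed.

End GeneratingFunctions.

Theorem corollary3p7 (n : nat) : pp (3 * n + 2) = 0 %[mod 3].
Proof.
set N := 3 * n + 2.
have pchar3 : 3 \in [pchar 'F_3]%R by apply: pchar_Fp.
apply/eqP; rewrite mod0n -/(3 %| _) (dvdn_pcharf pchar3).
pose A := op_poly 'F_3 N.+1 N; pose S : {poly 'F_3}%R := theta 'X%R N.
(* Truncation is harmless: the coefficient of degree [N] only involves coefficients of degree at
   most [N]. *)
have -> : ((pp N)%:R = (A * A)`_N :> 'F_3)%R.
  rewrite pp_overpartitions coefM natr_sum; apply: eq_bigr => i _.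
  by rewrite natrM !coef_poly ltn_ord ltnS leq_subr.
have dvdAA : ('X^(N.+1) %| A * A - A ^+ 3 * S)%R.
  rewrite (_ : _ - _ = - A ^+ 2 * (A * S - 1))%R; last by ring.
  by rewrite dvdp_mull // op_poly_theta.
have /eqP := dvdXnP _ _ dvdAA N (ltnSn N).
rewrite coefB subr_eq0 => /eqP ->; rewrite coefM big1 // => i _.
(* If 3 does not divide [i], the coefficient of [A ^+ 3] vanishes; otherwise [N - i] is 2 modulo 3
   and that of [S] vanishes. *)
have [i3|i3] := boolP (3 %| i); last by rewrite (coef_exp_pchar _ pchar3) ?mul0r.
rewrite coef_theta ?mulr0 //.
have le_iN : i <= N by rewrite -ltnS.
apply/eqP; rewrite -[2]/(2 %% 3) -(eqn_modDl i) subnKC // /N.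
by rewrite eqn_modDr modnMr eq_sym.
Qed.
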